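(* For every pair $k,q$ of integers satisfying $q\ge -1$ and $k\ge q+3$ there exists a constant $d=d(k,q)$ such that for every integer $n\ge k-q-1$, $$f^{(2)}(n,k-q-1,k)-\mathrm{ex}(n,\mathcal{H}^{(2)}(k,q))\le d.$$
   Context: Graphs are finite and simple (no loops, no multiple edges); isolated vertices are allowed. $V(H)$ and $E(H)$ denote the vertex and edge sets of $H$. Subgraphs are not necessarily induced. For a family $\mathcal{F}$ of graphs, a graph is $\mathcal{F}$-free if it has no subgraph isomorphic to a member of $\mathcal{F}$, and $\mathrm{ex}(n,\mathcal{F})$ is the maximum number of edges in an $\mathcal{F}$-free graph on $n$ vertices. For integers $q\ge -1$ and $k\ge q+3$, $\mathcal{H}^{(2)}(k,q)$ is the family of all graphs $H$ with $|E(H)|-|V(H)|=q+1$ and $q+3\le |E(H)|\le k$. For integers $v\ge 2$ and $k\ge 2$, $f^{(2)}(n,v,k)-1$ denotes the maximum number of edges in a graph on $n$ vertices that contains no subgraph with $v$ vertices and at least $k$ edges (equivalently, no subgraph with exactly $v$ vertices and exactly $k$ edges). *)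

(* Defs.v *)
From HB Require Import structures.
From mathcomp Require Import all_boot all_order all_algebra.
From mathcomp Require Import boolp.

Set Implicit Arguments.
Unset Strict Implicit.
Unset Printing Implicit Defensive.

Import Order.TTheory GRing.Theory Num.Theory.
Local Open Scope ring_scope.

(* Finite simple graphs with vertex set T. *)
Record sgraph (T : finType) := SGraph {
  edges : {set {set T}};
  edges_card2 : [forall e in edges, #|e| == 2]
}.

HB.instance Definition _ (T : finType) := [isSub for @edges T].
HB.instance Definition _ (T : finType) := [Finite of sgraph T by <:].

(* (W, F) is the vertex set and edge set of a (not necessarily induced)
   subgraph of G. *)
Definition is_subgraph (T : finType) (G : sgraph T)
    (W : {set T}) (F : {set {set T}}) : Prop :=
  F \subset edges G /\ (forall e, e \in F -> e \subset W).

(* H is isomorphic to the graph (W, F), where W and F live in an ambient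
   vertex type T. *)
Definition isomorphic_to (U : finType) (H : sgraph U)
    (T : finType) (W : {set T}) (F : {set {set T}}) : Prop :=
  exists f : U -> T,
    [/\ injective f,
        f @: [set: U] = W
      & (fun e : {set U} => f @: e) @: edges H = F].

Definition graph_family := forall U : finType, sgraph U -> Prop.

Definition family_free (FF : graph_family) (T : finType) (G : sgraph T) : Prop :=
  ~ exists (U : finType) (H : sgraph U) (W : {set T}) (F : {set {set T}}),
      [/\ FF U H, is_subgraph G W F & isomorphic_to H W F].

(* The maximum is 0 by convention when no graph satisfies P. *)
Definition max_edges (n : nat) (P : sgraph 'I_n -> Prop) : nat :=
  (\max_(G : sgraph 'I_n | `[< P G >]) #|edges G|)%N.

Definition ex (n : nat) (FF : graph_family) : nat :=
  max_edges (@family_free FF 'I_n).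

Definition H2 (k q : int) : graph_family := fun U H =>
  #|edges H|%:Z - #|U|%:Z = q + 1 /\ q + 3 <= #|edges H|%:Z <= k.

Definition no_dense_subgraph (v k : int) (T : finType) (G : sgraph T) : Prop :=
  ~ exists (W : {set T}) (F : {set {set T}}),
      [/\ is_subgraph G W F, #|W|%:Z = v & k <= #|F|%:Z].

(* f2 n v k - 1 is the extremal number. *)
Definition f2 (n : nat) (v k : int) : nat :=
  (max_edges (@no_dense_subgraph v k 'I_n)).+1.

(* Main.v *)
Require Import Defs.
From mathcomp Require Import all_boot all_order all_algebra.
From mathcomp Require Import boolp zify.

(** Put s = q + 1 and v = k - s, so that G is (v, k)-free when no v vertices
of G span v + s edges. Call a vertex set W with at most v vertices dense if it
spans at least #|W| + s edges; a copy of a member of the family is carried by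
a dense set of at least 2 vertices. A (v, k)-free graph G may well have dense
sets of fewer than v vertices, and they are eliminated as follows.

A dense set W with an edge leaving it stays dense when the outer end of that
edge is added. This growth cannot reach v vertices, so it stops at a union of
components of G with fewer than v vertices in total ([dense_closed_hull]).
Hence every dense set lies in the union S of all components with fewer than v
vertices. All degrees in S are less than v, so S spans at most v #|S| / 2
edges. Possibly linearly many edges have to go, since S may consist of many
small components, and so the edges inside S are not merely deleted: they are
replaced by a graph F on S of girth greater than v which has at least
v #|S| / 2 - O(1) edges ([dense_sparse_edge_set]). If W is
nonempty and dense in the new graph, then W minus S is dense in G: what W has
in S spans a forest, with no more edges than vertices. So W minus S lies in S,
that is, W lies in S, and then W spans a forest itself and is not dense.
The new graph thus avoids the family, at a cost in edges which depends on
v only ([locally_sparse_replacement]).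

The graph F is found greedily, as in the theorem of Erdos and Sachs: take a
maximal graph on S of girth greater than v and maximum degree at most v. Two
vertices of degree less than v must be within distance v of each other, or
else they could be joined; so they all lie in one ball, which has at most
(v + 1)^v vertices, and all other vertices have degree exactly v. *)

Import Order.TTheory GRing.Theory Num.Theory.
Local Open Scope ring_scope.

(** * Edge sets *)

Section EdgeSets.
Set Implicit Arguments.
Unset Strict Implicit.
Unset Printing Implicit Defensive.
Local Open Scope nat_scope.
Variable T : finType.
Implicit Types (E F : {set {set T}}) (W C S : {set T}) (x y : T).

Definition is_edge_set E := [forall e in E, #|e| == 2].
Definition inside E W := [set e in E | e \subset W].
Definition incident E x := [set e in E | x \in e].

Lemma is_edge_setP E : reflect {in E, forall e : {set T}, #|e| = 2} (is_edge_set E).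
Proof. by apply: (iffP forall_inP) => h e /h /eqP. Qed.
Arguments is_edge_setP {E}.

Lemma edge_pair (e : {set T}) x y : #|e| = 2 -> x \in e -> y \in e -> x != y ->
  e = [set x; y].
Proof.
move=> e2 xe ye xy; apply/esym/eqP; rewrite eqEcard cards2 xy e2 andbT.
by apply/subsetP => z; rewrite !inE => /orP[]/eqP->.
Qed.

Lemma incident_incl E F x : E \subset F -> incident E x \subset incident F x.
Proof.
move=> /subsetP EF; apply/subsetP => e; rewrite !inE => /andP[/EF-> ->] //.
Qed.

Lemma inside0 E : is_edge_set E -> inside E set0 = set0.
Proof.
move=> /is_edge_setP E2; apply/setP => e; rewrite !inE subset0.
by apply/negP => /andP[/E2 e2 /eqP e0]; rewrite e0 cards0 in e2.
Qed.

Lemma handshake E S : is_edge_set E -> {in E, forall e : {set T}, e \subset S} ->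
  \sum_(x in S) #|incident E x| = #|E| * 2.
Proof.
move=> /is_edge_setP E2 ES.
transitivity (\sum_(x in S) \sum_(e in E) (x \in e : nat)).
  apply: eq_bigr => x _; rewrite -sum1_card big_mkcond /= [RHS]big_mkcond /=.
  by apply: eq_bigr => e _; rewrite inE; case: (e \in E); case: (x \in e).
rewrite exchange_big /= -sum_nat_const; apply: eq_bigr => e eE.
rewrite -(E2 e eE) -sum1_card [LHS]big_mkcond [RHS]big_mkcond /=.
apply: eq_bigr => x _; have [xe|_] := boolP (x \in e); last by case: ifP.
by rewrite (subsetP (ES e eE) _ xe).
Qed.

(** * Sparse edge sets of almost maximal size *)

(** This is girth greater than g: a graph with a cycle of length at most g has
at least as many edges as vertices on that cycle, and a nonempty forest has
fewer. The counting form makes paths and cycles dispensable. *)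
Definition sparse g F :=
  [forall W : {set T}, (0 < #|W| <= g) ==> (#|inside F W| < #|W|)].

Lemma sparseP g F :
  reflect (forall W, 0 < #|W| <= g -> #|inside F W| < #|W|) (sparse g F).
Proof.
by apply: (iffP forallP) => [h W Wg|h W]; [apply: (implyP (h W))|apply/implyP/h].
Qed.
Arguments sparseP {g F}.

Definition nbhd F (A : {set T}) := A :|: \bigcup_(y in A) \bigcup_(e in incident F y) (e :\ y).
Definition ball F x i := iter i (nbhd F) [set x].

Lemma card_bigcup_le (I : finType) (A : {set I}) (B : I -> {set T}) m :
  {in A, forall i, #|B i| <= m} -> #|\bigcup_(i in A) B i| <= #|A| * m.
Proof.
move=> Bm; apply: (@leq_trans (\sum_(i in A) #|B i|)); last first.
  by rewrite -sum_nat_const; apply: leq_sum.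
apply: (big_ind2 (fun (U : {set T}) n => #|U| <= n)) => //; first by rewrite cards0.
by move=> U m1 V m2 h1 h2; apply: leq_trans (leq_card_setU _ _) (leq_add h1 h2).
Qed.

Lemma card_ball F D x i : is_edge_set F -> (forall y, #|incident F y| <= D) ->
  #|ball F x i| <= D.+1 ^ i.
Proof.
move=> /is_edge_setP F2 FD; elim: i => [|i IH]; first by rewrite cards1.
rewrite /ball iterS -/(ball F x i) expnSr.
apply: leq_trans (leq_mul IH (leqnn _)); rewrite mulnS.
apply: leq_trans (leq_card_setU _ _) _; rewrite leq_add2l.
apply: card_bigcup_le => y _; apply: leq_trans (FD y).
rewrite -[leqRHS]muln1; apply: card_bigcup_le => e; rewrite inE => /andP[/F2 e2 ye].
by have := cardsD1 y e; rewrite ye e2; lia.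
Qed.

Lemma sub_ball F x i j : i <= j -> ball F x i \subset ball F x j.
Proof.
elim: j => [|j IH]; first by rewrite leqn0 => /eqP->.
rewrite leq_eqVlt => /predU1P[-> //|/IH h].
exact: subset_trans h (subsetUl _ _).
Qed.

Lemma ball_step F x i (e : {set T}) a b : e \in F -> a \in e -> b \in e ->
  a \in ball F x i -> b \in ball F x i.+1.
Proof.
move=> eF ae be ai; rewrite /ball iterS -/(ball F x i) inE.
have [->|ba] := eqVneq b a; first by rewrite ai.
apply/orP; right; apply/bigcupP; exists a => //; apply/bigcupP; exists e.
  by rewrite inE eF.
by rewrite !inE ba.
Qed.

(** A set W with #|W| - 1 edges in a sparse graph spans a tree: if W split into
two nonempty parts with no edge between them, it would have at most #|W| - 2
edges. So the balls around x gain a vertex of W at each step, until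
they contain all of W. *)
Lemma tight_sub_ball g F W x : sparse g F -> is_edge_set F ->
  #|W| <= g -> x \in W -> #|W| <= #|inside F W|.+1 -> W \subset ball F x g.
Proof.
move=> /sparseP Fs F2 Wg xW Wt.
suff h i : (W \subset ball F x i) || (i < #|W :&: ball F x i|).
  case/orP: (h g) => // gW; have := subset_leq_card (subsetIl W (ball F x g)).
  by lia.
elim: i => [|i IH].
  by apply/orP; right; apply/card_gt0P; exists x; rewrite !inE xW eqxx.
have [Wi|Wi] := boolP (W \subset ball F x i).
  by rewrite (subset_trans Wi (sub_ball _ _ (leqnSn i))).
have /= {}IH : i < #|W :&: ball F x i| by move: IH; rewrite (negPf Wi).
apply/orP; right.
set B := ball F x i in Wi IH *.
(* An edge of W with one end in the ball and the other outside. *)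
have [e eW [ea eb]] : exists2 e, e \in inside F W &
    ~~ (e \subset W :\: B) /\ ~~ (e \subset W :&: B).
  apply/exists2P; apply: contrapT => /forallNP no.
  have sub : inside F W \subset inside F (W :&: B) :|: inside F (W :\: B).
    apply/subsetP => e eW; have eF : e \in F by move: eW; rewrite inE => /andP[].
    rewrite !inE eF /=; apply/negPn/negP; rewrite negb_or => /andP[h1 h2].
    by apply: (no e).
  have D0 : 0 < #|W :\: B| by rewrite lt0n cards_eq0 setD_eq0.
  have WB := cardsID B W.
  have sparseI : #|inside F (W :&: B)| < #|W :&: B| by apply: Fs; lia.
  have sparseD : #|inside F (W :\: B)| < #|W :\: B| by apply: Fs; lia.
  have := leq_trans (subset_leq_card sub) (leq_card_setU _ _).
  by lia.
move: eW; rewrite inE => /andP[eF /subsetP eW].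
have [a ae aB] : exists2 a, a \in e & a \in B.
  by case/subsetPn: ea => a ae; rewrite inE eW // andbT negbK; exists a.
have [b be bB] : exists2 b, b \in e & b \notin B.
  by case/subsetPn: eb => b be; rewrite inE eW //=; exists b.
apply: (leq_ltn_trans IH); apply: proper_card; apply/properP; split.
  by apply: setIS; exact: sub_ball (leqnSn i).
exists b; first by rewrite inE eW //; apply: ball_step ae be aB.
by rewrite inE eW.
Qed.

(** A maximal sparse edge set of maximum degree at most D on S works: the
vertices of degree less than D are pairwise within distance g, hence lie in a
single ball, and the degree sum misses at most D for each of them. *)
Lemma dense_sparse_edge_set D g S : 0 < g -> exists F,
  [/\ is_edge_set F, {in F, forall e : {set T}, e \subset S}, sparse g F
    & D * #|S| <= #|F| * 2 + D * D.+1 ^ g].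
Proof.
move=> g0.
pose P F := [&& is_edge_set F, [forall e in F, e \subset S], sparse g F
  & [forall x, #|incident F x| <= D]].
have P0 : P set0.
  apply/and4P; split.
  - by apply/is_edge_setP => e; rewrite inE.
  - by apply/forall_inP => e; rewrite inE.
  - apply/sparseP => W /andP[W0 _]; apply: leq_ltn_trans W0.
    by rewrite leqn0 cards_eq0 -subset0; apply/subsetP => e; rewrite !inE.
  - apply/forallP => x; rewrite (_ : incident _ _ = set0) ?cards0 //.
    by apply/setP => e; rewrite !inE.
have [F /maxsetP[/and4P[F2 /forall_inP FS Fs /forallP FD] Fmax] _] := maxset_exists P0.
exists F; split => //.
pose L := [set x in S | #|incident F x| < D].
have Lcard : #|L| <= D.+1 ^ g.
  have [->|[x xL]] := set_0Vmem L; first by rewrite cards0.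
  apply: leq_trans (card_ball x g F2 FD); apply: subset_leq_card.
  apply/subsetP => y yL; apply/negPn/negP => yB.
  have xy : x != y.
    apply: contraNneq yB => <-; apply: (subsetP (sub_ball F x (leq0n g))).
    by rewrite inE.
  move: xL yL; rewrite !inE => /andP[xS xD] /andP[yS yD].
  have eF : [set x; y] \notin F.
    apply: contra yB => eF; apply: (subsetP (sub_ball F x g0)).
    by apply: (ball_step eF (a := x)); rewrite ?inE ?eqxx ?orbT.
  have : P ([set x; y] |: F) -> False.
    move=> /Fmax/(_ (subsetUr _ _)) FE; case/negP: eF.
    by rewrite -FE !inE eqxx.
  apply; apply/and4P; split.
  - apply/is_edge_setP => e; rewrite !inE => /predU1P[->|]; first by rewrite cards2 xy.
    exact: (is_edge_setP F2).
  - apply/forall_inP => e; rewrite !inE => /predU1P[->|]; last exact: FS.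
    by apply/subsetP => z; rewrite !inE => /orP[]/eqP->.
  - apply/sparseP => W /andP[W0 Wg].
    have FW : #|inside F W| < #|W| by apply: (sparseP Fs); rewrite W0.
    have insU : inside ([set x; y] |: F) W \subset [set x; y] |: inside F W.
      by apply/subsetP => e; rewrite !inE andb_orl => /orP[/andP[->]|->] //; rewrite orbT.
    have [eW|eW] := boolP ([set x; y] \subset W).
      have xW : x \in W by apply: (subsetP eW); rewrite !inE eqxx.
      have yW : y \in W by apply: (subsetP eW); rewrite !inE eqxx orbT.
      (* If adding xy destroys sparsity on W, then W was already a tree through
         x and y, which puts y in the ball around x. *)
      rewrite ltnNge; apply: contra yB => WF.
      apply: (subsetP (tight_sub_ball Fs F2 Wg xW _)) => //.
      apply: leq_trans WF (leq_trans (subset_leq_card insU) _).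
      by rewrite cardsU1; case: (_ \notin _).
    apply: leq_ltn_trans FW; apply: subset_leq_card; apply/subsetP => e.
    by rewrite !inE => /andP[/predU1P[->|->] //]; rewrite (negPf eW).
  - apply/forallP => z.
    have [ze|ze] := boolP (z \in [set x; y]).
      have zD : #|incident F z| < D by move: ze; rewrite !inE => /orP[]/eqP->.
      apply: leq_trans zD; apply: (@leq_trans #|[set x; y] |: incident F z|).
        apply: subset_leq_card; apply/subsetP => e.
        by rewrite !inE andb_orl => /orP[/andP[->]|->] //; rewrite orbT.
      by rewrite cardsU1; case: (_ \notin _).
    apply: leq_trans (FD z); apply: subset_leq_card; apply/subsetP => e.
    by rewrite !inE => /andP[/predU1P[->|->] //]; move: ze; rewrite !inE => /negPf->.
rewrite -(handshake F2 FS).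
have -> : D * #|S| = \sum_(x in S) D by rewrite sum_nat_const mulnC.
have LD : \sum_(x in S) D * (x \in L) <= D * D.+1 ^ g.
  rewrite -big_distrr /= leq_mul2l; apply/orP; right; apply: leq_trans Lcard.
  rewrite -sum1_card big_mkcond /= [leqRHS]big_mkcond /=.
  by apply: leq_sum => x _; case: (x \in S); case: (x \in L).
apply: leq_trans (leq_add (leqnn _) LD); rewrite -big_split /=.
apply: leq_sum => x xS; rewrite inE xS /=.
by case: ltnP => h; rewrite ?muln1 ?leq_addl // muln0 addn0.
Qed.

(** * Dense sets lie in small components *)

(** The edge-closed sets are the unions of connected components. *)
Definition edge_closed E C := [forall e in E, (e \subset C) || [disjoint e & C]].

Lemma edge_closedP E C : reflect
  (forall (e : {set T}) x y, e \in E -> x \in e -> y \in e -> x \in C -> y \in C) (edge_closed E C).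
Proof.
apply: (iffP forall_inP) => [h e x y /h /orP[/subsetP eC _ /eC //|eC] xe ye xC|h e eE].
  by rewrite (disjointFr eC xe) in xC.
have [//|/subsetPn[y ye yC] /=] := boolP (e \subset C).
rewrite disjoint_subset; apply/subsetP => x xe; rewrite inE.
by apply: contra yC; apply: h eE xe ye.
Qed.

(** A maximal dense superset of W with at most v vertices has no edge leaving
it: the outer end of such an edge could be added, with a gain of at least one
edge for the one new vertex. It does not have v vertices by the hypothesis on
the sets of size v. *)
Lemma dense_closed_hull v s E W : is_edge_set E ->
    (forall C, #|C| = v -> #|inside E C| < v + s) ->
    #|W| <= v -> #|W| + s <= #|inside E W| ->
  exists C, [/\ edge_closed E C, #|C| < v & W \subset C].
Proof.
move=> E2 Ev Wv Wd.
pose P C := (#|C| <= v) && (#|C| + s <= #|inside E C|).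
have [|C /maxsetP[/andP[Cv Cd] Cmax] WC] := @maxset_exists _ P W; first exact/andP.
have Cv' : #|C| < v.
  rewrite ltn_neqAle Cv andbT; apply/eqP => CE; have := Ev C CE.
  by rewrite -CE ltnNge Cd.
exists C; split => //; apply/edge_closedP => e x y eE xe ye xC.
apply/negPn/negP => yC.
suff /Cmax/(_ (subsetUr _ _)) CE : P (y |: C) by rewrite -CE !inE eqxx in yC.
rewrite /P cardsU1 yC add1n Cv' /= addSn; apply: leq_ltn_trans Cd _.
apply: proper_card; apply/properP; split.
  apply/subsetP => e'; rewrite !inE => /andP[-> /subset_trans -> //].
  exact: subsetUr.
have xy : x != y by apply: contraNneq yC => <-.
exists e; rewrite inE eE /=.
  rewrite (edge_pair (is_edge_setP E2 e eE) xe ye xy).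
  by apply/subsetP => z; rewrite !inE => /orP[]/eqP->; rewrite ?eqxx ?xC ?orbT.
by apply/subsetPn; exists y.
Qed.

Lemma incident_closed E C x : is_edge_set E -> edge_closed E C -> x \in C ->
  #|incident E x| <= #|C|.
Proof.
move=> /is_edge_setP E2 /edge_closedP CE xC.
apply: (@leq_trans #|[set [set x; y] | y in C]|); last exact: leq_imset_card.
apply: subset_leq_card; apply/subsetP => e; rewrite inE => /andP[eE xe].
have : 0 < #|e :\ x| by have := cardsD1 x e; rewrite xe E2 //; lia.
case/card_gt0P => y; rewrite !inE => /andP[yx ye].
apply/imsetP; exists y; first exact: CE eE xe ye xC.
by apply: edge_pair; rewrite 1?eq_sym ?E2.
Qed.

(** The union of the components with fewer than v vertices. *)
Definition small_part v E := \bigcup_(C in [pred C | edge_closed E C && (#|C| < v)]) C.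

Lemma small_partP v E x :
  reflect (exists C, [/\ edge_closed E C, #|C| < v & x \in C]) (x \in small_part v E).
Proof.
apply: (iffP bigcupP) => [[C /andP[]]|[C [C1 C2 C3]]]; first by exists C.
by exists C => //; apply/andP.
Qed.

Lemma small_part_closed v E : edge_closed E (small_part v E).
Proof.
apply/edge_closedP => e x y eE xe ye /small_partP[C [/edge_closedP CE Cv xC]].
by apply/small_partP; exists C; split => //; [apply/edge_closedP|apply: CE eE xe ye xC].
Qed.

(** A vertex in a component with fewer than v vertices has degree less than v. *)
Lemma card_inside_small_part v E : is_edge_set E ->
  #|inside E (small_part v E)| * 2 <= v * #|small_part v E|.
Proof.
move=> E2; set S := small_part v E.
rewrite -(@handshake (inside E S) S); first last.
- by move=> e; rewrite inE => /andP[].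
- by apply/is_edge_setP => e; rewrite inE => /andP[/(is_edge_setP E2)].
rewrite mulnC -sum_nat_const; apply: leq_sum => x /small_partP[C [CE Cv xC]].
apply: leq_trans (ltnW Cv); apply: leq_trans (incident_closed E2 CE xC).
by apply/subset_leq_card/incident_incl/subsetP => e; rewrite inE => /andP[].
Qed.

(** * Replacing the small components *)

(** The edges inside the small part give way to a sparse edge set F, which costs
only a constant number of edges as F is almost v-regular. If W were dense for
the new edges, then so would be W minus the small part for the old ones, since
the sparse edges contribute no surplus; it would then lie in the small part, so
be empty, and W would span a forest. *)
Lemma locally_sparse_replacement v s E : 0 < v -> is_edge_set E ->
    (forall C, #|C| = v -> #|inside E C| < v + s) ->
  exists E', [/\ is_edge_set E',
    forall W, 0 < #|W| <= v -> #|inside E' W| < #|W| + s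
    & #|E| <= #|E'| + v * v.+1 ^ v].
Proof.
move=> v0 E2 Ev; set S := small_part v E.
have [F [F2 FS /sparseP Fs Fcard]] := dense_sparse_edge_set v S v0.
have insE e : e \in E :\: inside E S -> e \in E /\ [disjoint e & S].
  rewrite !inE => /andP[eS eE]; split=> //; move: eS; rewrite eE /=.
  by have /forall_inP/(_ e eE)/orP[->|] := small_part_closed v E.
exists ((E :\: inside E S) :|: F); split.
- apply/is_edge_setP => e /setUP[/insE[eE _]|]; last exact: (is_edge_setP F2).
  exact: (is_edge_setP E2).
- move=> W /andP[W0 Wv]; rewrite ltnNge; apply/negP => Wd.
  have sub : inside ((E :\: inside E S) :|: F) W
      \subset inside E (W :\: S) :|: inside F (W :&: S).
    apply/subsetP => e; rewrite inE => /andP[/setUP[/insE[eE eS] eW|eF eW]].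
      by rewrite !inE eE subsetD eW eS.
    by rewrite !inE eF subsetI eW FS // orbT.
  have c := leq_trans Wd (leq_trans (subset_leq_card sub) (leq_card_setU _ _)).
  have WSD := cardsID S W.
  (* On an empty set the surplus bound is 0 instead of -1. *)
  have FW : #|inside F (W :&: S)| <= #|W :&: S| - (0 < #|W :&: S|).
    have [W'0|W'0] := posnP #|W :&: S|.
      by move/eqP: W'0; rewrite cards_eq0 => /eqP->; rewrite inside0 ?cards0.
    by have := Fs (W :&: S); rewrite W'0 /=; lia.
  have [||C [CE Cv WC]] := @dense_closed_hull v s E (W :\: S) E2 Ev; try lia.
  have D0 : W :\: S = set0.
    apply/setP => x; rewrite in_set0; apply/negP => xW.
    have : x \in S by apply/small_partP; exists C; split => //; apply: (subsetP WC).
    by move: xW; rewrite inE => /andP[/negPf->].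
  by move: c WSD; rewrite D0 inside0 // cards0; lia.
- have disj : (E :\: inside E S) :&: F = set0.
    apply/setP => e; rewrite in_set0; apply/negP => /setIP[/insE[eE eS] eF].
    have := is_edge_setP F2 e eF; rewrite (_ : e = set0) ?cards0 //.
    by rewrite -(setIidPl (FS e eF)); apply/eqP; rewrite setI_eq0.
  rewrite cardsU disj cards0 subn0.
  have Sb := card_inside_small_part v E2; rewrite -/S in Sb.
  have := cardsID (inside E S) E.
  have -> : E :&: inside E S = inside E S.
    by apply/setIidPr/subsetP => e; rewrite inE => /andP[].
  by lia.
Qed.

End EdgeSets.

Theorem theorem11 (k q : int) (hq : -1 <= q) (hk : q + 3 <= k) :
  exists d : int, forall n : nat, k - q - 1 <= n%:Z ->
    (f2 n (k - q - 1) k)%:Z - (ex n (H2 k q))%:Z <= d.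
Proof.
have [s sE] : exists s : nat, q = s%:Z - 1 by exists (absz (q + 1)); lia.
have [v vE] : exists v : nat, k = v%:Z + s%:Z by exists (absz (k - s%:Z)); lia.
have v2 : (1 < v)%N by lia.
(* The extra 1 in the constant comes from the offset between f2 and the
   extremal number. *)
exists (v * v.+1 ^ v).+1%:Z => n _; rewrite {}sE {}vE {hq hk k q}.
suff : (max_edges (@no_dense_subgraph (v%:Z + s%:Z - (s%:Z - 1) - 1) (v%:Z + s%:Z) 'I_n)
        <= ex n (H2 (v%:Z + s%:Z) (s%:Z - 1)) + v * v.+1 ^ v)%N.
  by rewrite /f2; lia.
apply/bigmax_leqP => G /asboolP Gfree.
have [|||E' [E'2 E's E'card]] := @locally_sparse_replacement _ v s (edges G).
- by lia.
- exact: edges_card2.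
- move=> C Cv; rewrite ltnNge; apply/negP => Cd; apply: Gfree.
  exists C, (inside (edges G) C); split; [|lia|lia].
  by split=> [|e]; [apply/subsetP => e|]; rewrite inE => /andP[].
apply: leq_trans E'card _; rewrite leq_add2r.
apply: (@leq_bigmax_cond _ _ (fun G : sgraph 'I_n => #|edges G|) (SGraph E'2)).
apply/asboolP => -[U [H [W [F [[HU HE] [/= FE FW] [f [finj fW fF]]]]]]].
have Wcard : #|W| = #|U| by rewrite -fW card_imset // cardsT.
have Fcard : #|F| = #|edges H| by rewrite -fF card_imset //; apply: imset_inj.
have FinW : (#|F| <= #|inside E' W|)%N.
  apply/subset_leq_card/subsetP => e eF.
  by rewrite inE (subsetP FE) // FW.
by have := E's W; lia.
Qed.
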